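(* Let $\pi\in\mathbb S_r$ have cycle type $\lambda$, acting on $X=\{1,\dots,r\}$, and let $\mathcal C$ be the set of orbits of $\langle\pi^2\rangle$ acting on $X\times X$ by $(x,y)\mapsto(x\pi^2,y\pi^2)$. Then $\mathcal C$ consists of exactly $\eta(\lambda)$ orbits $\Gamma$ with $\Gamma\pi\tau=\Gamma$, together with exactly $\zeta(\lambda)$ unordered pairs $\{\Gamma,\Gamma\pi\tau\}$ with $\Gamma\pi\tau\ne\Gamma$, where $$\zeta(\lambda)=\tfrac12\sum_{i=1}^{s}\big((1+e_i)(\lambda_i+1)-2(f_i+1)\big)+\sum_{1\le i<j\le s}(1+e_{ij})\gcd(\lambda_i,\lambda_j),\qquad \eta(\lambda)=\sum_{i=1}^{s}(1-e_i+2f_i).$$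
   Context: $\tau:X\times X\to X\times X$ is $(x,y)\tau=(y,x)$ and $\Gamma\pi\tau=\{(y\pi,x\pi):(x,y)\in\Gamma\}$. The cycle lengths of $\pi$, listed with repetition, are $\lambda_1,\dots,\lambda_s$. $e_i=1$ if $\lambda_i$ is even, else $0$; $f_i=1$ if $\lambda_i\equiv2\pmod4$, else $0$; $e_{ij}=1$ if at least one of $\lambda_i,\lambda_j$ is even, else $0$. *)

(* Defs.v *)
From HB Require Import structures.
From mathcomp Require Import all_boot all_order all_algebra all_fingroup.

Set Implicit Arguments.
Unset Strict Implicit.
Unset Printing Implicit Defensive.

Import GRing.Theory.

Section PairAction.
Variable T : finType.

Definition pair_perm (p : T * T) (s : {perm T}) : T * T := (s p.1, s p.2).

Lemma pair_perm1 : pair_perm^~ 1%g =1 id.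
Proof. by case=> x y; rewrite /pair_perm /= !perm1. Qed.

Lemma pair_permM p : act_morph pair_perm p.
Proof. by case: p => x y s t; rewrite /pair_perm /= !permM. Qed.

Definition pair_action : {action {perm T} &-> T * T} :=
  TotalAction pair_perm1 pair_permM.

Definition tau (p : T * T) : T * T := (p.2, p.1).

Definition pitau (pi : {perm T}) (G : {set T * T}) : {set T * T} :=
  [set tau (pair_action p pi) | p in G].

Definition sq_orbits (pi : {perm T}) : {set {set T * T}} :=
  [set orbit pair_action <[(pi ^+ 2)%g]>%g p | p in [set: T * T]].

Definition fixed_orbits (pi : {perm T}) : {set {set T * T}} :=
  [set G in sq_orbits pi | pitau pi G == G].

Definition moved_orbits (pi : {perm T}) : {set {set T * T}} :=
  [set G in sq_orbits pi | pitau pi G != G].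

Definition moved_pairs (pi : {perm T}) : {set {set {set T * T}}} :=
  [set [set G; pitau pi G] | G in moved_orbits pi].

(* [lambda] may list the cycle lengths (fixed points included) in any order. *)
Definition has_cycle_type (pi : {perm T}) (lambda : seq nat) : bool :=
  perm_eq lambda [seq #|(C : {set T})| | C in porbits pi].

End PairAction.

Definition e1 (l : nat) : nat := ~~ odd l.
Definition f1 (l : nat) : nat := l %% 4 == 2.
Definition e2 (l m : nat) : nat := ~~ odd l || ~~ odd m.

Local Open Scope ring_scope.

(* Rational-valued: nat division and subtraction would truncate. *)
Definition zeta (lambda : seq nat) : rat :=
  let l := nth 0%N lambda in
  2%:R^-1 * (\sum_(i < size lambda)
      ((1 + (e1 (l i))%:R) * ((l i)%:R + 1) - 2%:R * ((f1 (l i))%:R + 1)))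
  + \sum_(i < size lambda) \sum_(j < size lambda | (i < j)%N)
      (1 + (e2 (l i) (l j))%:R) * (gcdn (l i) (l j))%:R.

Definition eta (lambda : seq nat) : rat :=
  let l := nth 0%N lambda in
  \sum_(i < size lambda) (1 - (e1 (l i))%:R + 2%:R * (f1 (l i))%:R).

(* Main.v *)
(** The map [sigma = pi tau : (x, y) |-> (y pi, x pi)] squares to the action of
    [pi^2] on pairs, so it permutes the orbits of [<pi^2>] by an involution.  The
    orbits are counted by weighting each pair [p] with [1 / #|orbit p|].  If [x]
    and [y] lie on cycles of lengths [l] and [m], the orbit of [(x, y)] has
    length [h (lcm l m)], where [h L] is [L] for odd [L] and [L / 2] for even
    [L]; this orbit is fixed by [sigma] iff [y = pi^(h l) x] with [h l] odd.
    Summing the weights cycle by cycle gives [eta] and the total number of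
    orbits, and half of their difference is [zeta]. *)

Require Import Defs.
From mathcomp Require Import all_boot all_order all_algebra all_fingroup.
From mathcomp Require Import ring zify.
Set Implicit Arguments.
Unset Strict Implicit.
Unset Printing Implicit Defensive.
Import GRing.Theory Num.Theory.
Local Open Scope ring_scope.

(** * Arithmetic of the order of a square *)

Section SquareOrder.
Local Open Scope nat_scope.

(** The order of [g ^+ 2] when [g] has order [n]. *)
Definition sq_order (n : nat) : nat := if odd n then n else n./2.

Lemma sq_order_gt0 (n : nat) : 0 < n -> 0 < sq_order n.
Proof. by rewrite /sq_order; case: ifP; lia. Qed.

Lemma sq_orderE (n : nat) : n = sq_order n * (1 + e1 n).
Proof. by rewrite /sq_order /e1; case: ifP; lia. Qed.

Lemma dvdn_sq_order (n k : nat) : (sq_order n %| k) = (n %| k * 2).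
Proof.
rewrite /sq_order; case: ifP => on.
  by rewrite Gauss_dvdl // coprimen2.
have {2}-> : n = n./2 * 2 by lia.
by rewrite dvdn_pmul2r.
Qed.

Lemma odd_lcmn (l m : nat) : odd (lcmn l m) = odd l && odd m.
Proof.
rewrite -[odd (lcmn l m)]negbK -[odd l]negbK -[odd m]negbK -!dvdn2.
have [d2l|nd2l] := boolP (2 %| l).
  by rewrite (dvdn_trans d2l (dvdn_lcml _ _)).
have [d2m|nd2m] := boolP (2 %| m).
  by rewrite (dvdn_trans d2m (dvdn_lcmr _ _)).
apply: contra nd2l => /dvdn_trans dv.
have : 2 %| l * m by apply: dv; rewrite dvdn_lcm dvdn_mulr // dvdn_mull.
by rewrite Euclid_dvdM // (negbTE nd2m) orbF.
Qed.

(** The [l * m] pairs over two cycles split into orbits of equal length [sq_order (lcmn l m)], so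
    the other factor counts these orbits; it is the summand of the double sum in [zeta]. *)
Lemma muln_sq_order_lcm (l m : nat) :
  l * m = sq_order (lcmn l m) * ((1 + e2 l m) * gcdn l m).
Proof.
have -> : e2 l m = e1 (lcmn l m) by rewrite /e2 /e1 odd_lcmn negb_and.
by rewrite mulnA -sq_orderE muln_lcm_gcd.
Qed.

(** The product is what a cycle of length [n] contributes to [eta]; [e1 n] is added on the left to
    avoid truncated subtraction. The cases are [n] odd, 2 mod 4 and 0 mod 4. *)
Lemma odd_sq_order (n : nat) :
  odd (sq_order n) * (1 + e1 n) + e1 n = 1 + 2 * f1 n.
Proof. by rewrite /sq_order /e1 /f1; case: ifP; lia. Qed.

End SquareOrder.

(** * Weighted counting of orbits of a permutation *)

Section PermOrbits.
Variable T : finType.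
Implicit Types (s : {perm T}) (x y : T).

Lemma card_porbit_gt0 s x : (0 < #|porbit s x|)%N.
Proof. by rewrite lt0n card_porbit_neq0. Qed.

Lemma expg_porbit_mod s x k : (s ^+ k)%g x = (s ^+ (k %% #|porbit s x|))%g x.
Proof.
rewrite {1}(divn_eq k #|porbit s x|) expgD permM; congr (_ _).
rewrite mulnC expgM permX; elim: (_ %/ _)%N => //= n ->.
by rewrite permX iter_porbit.
Qed.

Lemma expg_fix_dvdn s x k : ((s ^+ k)%g x == x) = (#|porbit s x| %| k)%N.
Proof.
rewrite expg_porbit_mod /dvdn; have lt := ltn_pmod k (card_porbit_gt0 s x).
(* Both points are entries of the duplicate-free list of the orbit starting at [x], so they agree
   only if the reduced exponent is 0. *)
rewrite -(nth_uniq x _ _ (uniq_traject_porbit s x)) ?size_traject ?card_porbit_gt0 //.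
by rewrite !nth_traject ?card_porbit_gt0 //= permX.
Qed.

Lemma card_porbits_weight s (P : pred {set T}) :
  (#|[set C in porbits s | P C]|)%:R
    = \sum_(x | P (porbit s x)) (#|porbit s x|%:R)^-1 :> rat.
Proof.
rewrite (partition_big (porbit s) (mem [set C in porbits s | P C])) /=; last first.
  by move=> x Px; rewrite inE Px imset_f.
rewrite -sum1_card natr_sum; apply: eq_bigr => C.
rewrite inE => /andP[/imsetP[x _ ->] PC].
rewrite (eq_bigl (fun y => y \in porbit s x)); last first.
  move=> y; rewrite -eq_porbit_mem.
  by case: eqP => [->|]; rewrite ?PC ?andbF.
rewrite (eq_bigr (fun=> (#|porbit s x|%:R)^-1)); last first.
  by move=> y; rewrite -eq_porbit_mem => /eqP->.
by rewrite sumr_const -[RHS]mulr_natl divff // pnatr_eq0 -lt0n card_porbit_gt0.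
Qed.

(** Turns sums over points into sums over the cycle type: a cycle of length [l] has [l] points, each
    contributing [F l]. *)
Lemma sum_card_porbit (F : nat -> rat) s (lambda : seq nat) :
  has_cycle_type s lambda ->
  \sum_x F #|porbit s x| = \sum_(l <- lambda) l%:R * F l.
Proof.
move=> hl; rewrite (perm_big _ hl) /= big_image /=.
rewrite (partition_big (porbit s) (mem (porbits s))) /=; last first.
  by move=> x _; rewrite imset_f.
apply: eq_bigr => C /imsetP[x _ ->].
rewrite (eq_bigl (fun y => y \in porbit s x)); last first.
  by move=> y; rewrite -eq_porbit_mem.
rewrite (eq_bigr (fun=> F #|porbit s x|)); last first.
  by move=> y; rewrite -eq_porbit_mem => /eqP->.
by rewrite sumr_const mulr_natl.
Qed.

End PermOrbits.

Lemma cycle_type_gt0 (T : finType) (s : {perm T}) (lambda : seq nat) (l : nat) :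
  has_cycle_type s lambda -> l \in lambda -> (0 < l)%N.
Proof.
move=> hl; rewrite (perm_mem hl) => /imageP[C /imsetP[x _ ->] ->].
exact: card_porbit_gt0.
Qed.

(** * Involutions and symmetric double sums *)

Lemma partition_involution (T : finType) (A : {set T}) (f : T -> T) :
    {in A, forall x, f x \in A} -> {in A, forall x, f (f x) = x} ->
  partition [set [set x; f x] | x in A] A.
Proof.
move=> fA ff; apply/and3P; split.
- apply/eqP/setP=> x; apply/bigcupP/idP.
    case=> _ /imsetP[y yA ->]; rewrite !inE => /orP[]/eqP-> //; exact: fA.
  by move=> xA; exists [set x; f x]; [exact: imset_f | rewrite !inE eqxx].
(* A block is determined by any of its members, so two blocks sharing [z] coincide. *)
- have block x z : x \in A -> z \in [set x; f x] -> [set x; f x] = [set z; f z].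
    move=> xA; rewrite !inE => /orP[]/eqP-> //.
    by rewrite ff // setUC.
  apply/trivIsetP=> _ _ /imsetP[x xA ->] /imsetP[y yA ->]; apply: contraR.
  case/pred0Pn=> z /andP[/= zx zy].
  by rewrite (block _ _ xA zx) (block _ _ yA zy).
- apply/imsetP=> -[x _] /setP/(_ x).
  by rewrite !inE eqxx.
Qed.

Lemma card_partition_involution (T : finType) (A : {set T}) (f : T -> T) :
    {in A, forall x, f x \in A} -> {in A, forall x, f (f x) = x} ->
    {in A, forall x, f x != x} ->
  #|A| = (#|[set [set x; f x] | x in A]| * 2)%N.
Proof.
move=> fA ff nf; apply: card_uniform_partition; last exact: partition_involution.
by move=> _ /imsetP[x xA ->]; rewrite cards2 eq_sym nf.
Qed.

Lemma sum_symmetric (n : nat) (G : nat -> nat -> rat) :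
  (forall i j, G i j = G j i) ->
  \sum_(i < n) \sum_(j < n) G i j =
    \sum_(i < n) G i i + 2%:R * \sum_(i < n) \sum_(j < n | (i < j)%N) G i j.
Proof.
move=> Gsym.
have -> : 2%:R * \sum_(i < n) \sum_(j < n | (i < j)%N) G i j =
    \sum_(i < n) (\sum_(j < n | (i < j)%N) G i j + \sum_(j < n | (j < i)%N) G i j).
  rewrite big_split /= mulr_natl mulr2n; congr (_ + _).
  rewrite (exchange_big_dep xpredT) //=.
  by apply: eq_bigr => i _; apply: eq_bigr => j _; exact: Gsym.
rewrite -big_split /=; apply: eq_bigr => i _.
rewrite (bigD1 i) //=; congr (_ + _).
rewrite (bigID (fun j : 'I_n => (i < j)%N)) /=.
by congr (_ + _); apply: eq_bigl => j; rewrite -val_eqE /=; lia.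
Qed.

(** * Orbits of the squared permutation on pairs *)

Section PairOrbits.
Variables (T : finType) (pi : {perm T}).
Implicit Types (p : T * T) (G : {set T * T}).

(** Viewing the action of [pi ^+ 2] as a permutation of pairs makes the orbit counts above
    applicable. *)
Let sq : {perm T * T} := actperm (pair_action T) (pi ^+ 2)%g.
Let sigma (p : T * T) : T * T := tau (pair_action T p pi).

Lemma sq_orbitsE : sq_orbits pi = porbits sq.
Proof.
rewrite /sq_orbits /porbits; apply/setP => C.
by apply/imsetP/imsetP => -[p _ ->]; exists p; rewrite ?inE // porbit_actperm ?inE.
Qed.

Lemma sqX k p : (sq ^+ k)%g p = ((pi ^+ (k * 2))%g p.1, (pi ^+ (k * 2))%g p.2).
Proof.
elim: k => [|k IH]; first by rewrite !expg0 !perm1; case: p.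
by rewrite expgSr permM IH actpermE /= /pair_perm /= -!permM -!expgD mulSn addnC.
Qed.

Lemma sigmaK p : sigma (sigma p) = sq p.
Proof. by rewrite actpermE /sigma /= /tau /pair_perm /= !permM. Qed.

Lemma sigma_sqX k p : sigma ((sq ^+ k)%g p) = (sq ^+ k)%g (sigma p).
Proof.
by rewrite !sqX /sigma /= /tau /pair_perm /= -!permM -!expgSr -!expgS.
Qed.

Lemma pitau_porbit p : pitau pi (porbit sq p) = porbit sq (sigma p).
Proof.
apply/setP=> q; apply/imsetP/porbitP.
  by case=> _ /porbitP[k ->] ->; exists k; rewrite -sigma_sqX.
by case=> k ->; exists ((sq ^+ k)%g p); [exact: mem_porbit | rewrite -sigma_sqX].
Qed.

(** [sq ^+ k] fixes [p] iff both cycle lengths divide [k * 2]; the two sides thus have the same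
    multiples. *)
Lemma card_porbit_sq p :
  #|porbit sq p| = sq_order (lcmn #|porbit pi p.1| #|porbit pi p.2|).
Proof.
have dv k : (#|porbit sq p| %| k)%N =
    (sq_order (lcmn #|porbit pi p.1| #|porbit pi p.2|) %| k)%N.
  rewrite -expg_fix_dvdn sqX dvdn_sq_order dvdn_lcm -!expg_fix_dvdn.
  by case: p => x y; rewrite -[LHS]/(_ && _).
by apply/eqP; rewrite eqn_dvd dv dvdnn -dv dvdnn.
Qed.

Lemma pitau_fix_porbit x y :
  (pitau pi (porbit sq (x, y)) == porbit sq (x, y)) =
    odd (sq_order #|porbit pi x|) && (y == (pi ^+ sq_order #|porbit pi x|)%g x).
Proof.
set h := sq_order _.
have fix2h : (pi ^+ (h * 2))%g x = x.
  by apply/eqP; rewrite expg_fix_dvdn -dvdn_sq_order.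
have fix2hM c : (pi ^+ (h * 2 * c))%g x = x.
  by apply/eqP; rewrite expg_fix_dvdn dvdn_mulr // -expg_fix_dvdn fix2h.
rewrite pitau_porbit eq_porbit_mem porbit_sym; apply/porbitP/andP.
  case=> k; rewrite sqX /sigma /= /tau /pair_perm /= -!permM -!expgS => -[Ex Ey].
  (* The power [(k * 2).+1] of [pi] swaps [x] and [y], so its square fixes [x]. As a divisor of an
     odd number, [h] is then odd, and so is the cofactor [c]. *)
  have dvh : (h %| (k * 2).+1)%N.
    rewrite dvdn_sq_order -expg_fix_dvdn muln2 -addnn expgD permM.
    by rewrite -Ey -Ex.
  have [c Ec] := dvdnP dvh.
  have /andP[oc oh] : odd c && odd h by rewrite -oddM -Ec /= oddM andbF.
  split=> //; rewrite Ey Ec.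
  (* Since [c] is odd, [c * h] differs from [h] by a multiple of [h * 2], a period of [x]. *)
  have -> : (c * h = h * 2 * c./2 + h)%N by rewrite -{1}(odd_double_half c) oc; lia.
  by rewrite expgD permM fix2hM.
(* For odd [h] this witness gives the exponent [(h./2 * 2).+1 = h], and [pi ^+ h] swaps [x] and
   [y]. *)
case=> oh /eqP Ey; exists h./2.
rewrite sqX /sigma /= /tau /pair_perm /= -!permM -!expgS.
have -> : (h./2 * 2).+1 = h by lia.
by rewrite Ey -permM -expgD addnn -muln2 fix2h.
Qed.

Lemma pitau_sq_orbits G :
  G \in sq_orbits pi -> pitau pi G \in sq_orbits pi.
Proof. by rewrite sq_orbitsE => /imsetP[p _ ->]; rewrite pitau_porbit imset_f. Qed.

Lemma pitauK G : G \in sq_orbits pi -> pitau pi (pitau pi G) = G.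
Proof.
rewrite sq_orbitsE => /imsetP[p _ ->]; rewrite !pitau_porbit sigmaK.
(* [sigma] squares to [sq], which maps each of its orbits to itself. *)
by rewrite -(porbit_perm sq 1 p) expg1.
Qed.

Lemma pitau_moved G : G \in moved_orbits pi -> pitau pi G \in moved_orbits pi.
Proof.
rewrite !inE => /andP[GO mG]; rewrite pitau_sq_orbits //=.
by rewrite pitauK // eq_sym.
Qed.

Lemma moved_pairs_partition : partition (moved_pairs pi) (moved_orbits pi).
Proof.
apply: partition_involution => G; first exact: pitau_moved.
by rewrite inE => /andP[GO _]; exact: pitauK.
Qed.

Lemma card_sq_orbits :
  #|sq_orbits pi| = (#|fixed_orbits pi| + #|moved_pairs pi| * 2)%N.
Proof.
rewrite -(@card_partition_involution _ (moved_orbits pi)).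
- rewrite -(cardsID [set G | pitau pi G == G] (sq_orbits pi)).
  by congr (_ + _)%N; apply: eq_card => G; rewrite !inE // andbC.
- exact: pitau_moved.
- by move=> G; rewrite inE => /andP[GO _]; exact: pitauK.
- by move=> G; rewrite inE => /andP[].
Qed.

Lemma card_fixed_orbits (lambda : seq nat) (hlambda : has_cycle_type pi lambda) :
  (#|fixed_orbits pi|)%:R = eta lambda.
Proof.
rewrite /fixed_orbits sq_orbitsE card_porbits_weight big_mkcond /=.
transitivity (\sum_x \sum_y
    if pitau pi (porbit sq (x, y)) == porbit sq (x, y)
    then (#|porbit sq (x, y)|%:R)^-1 else 0 : rat).
  by rewrite pair_bigA; apply: eq_bigr => -[x y] _.
(* The total weight of the fixed orbits' pairs with a given first coordinate on a cycle of length
   [l]. *)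
pose F l : rat := (odd (sq_order l))%:R / (sq_order l)%:R.
rewrite (eq_bigr (fun x => F #|porbit pi x|)) => [|x _].
  rewrite (sum_card_porbit F hlambda) /eta (big_nth 0%N) big_mkord.
  apply: eq_bigr => i _; set l := nth _ _ _.
  have l0 : (0 < l)%N by apply: (cycle_type_gt0 hlambda); exact: mem_nth.
  have h0 : (sq_order l)%:R != 0 :> rat by rewrite pnatr_eq0 -lt0n sq_order_gt0.
  have lE : l%:R = (sq_order l)%:R * (1 + (e1 l)%:R) :> rat.
    by rewrite {1}(sq_orderE l) natrM natrD.
  have E : (odd (sq_order l))%:R * (1 + (e1 l)%:R) + (e1 l)%:R
      = 1 + 2%:R * (f1 l)%:R :> rat.
    by rewrite -[in LHS](natrD _ 1) -natrM -natrD odd_sq_order natrD natrM.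
  apply: (addIr (e1 l)%:R); rewrite /F lE.
  transitivity ((odd (sq_order l))%:R * (1 + (e1 l)%:R) + (e1 l)%:R : rat).
    by field.
  by rewrite E; ring.
(* At most one [y] survives in the inner sum; it lies on the cycle of [x], so the lcm is that of a
   length with itself. *)
rewrite -big_mkcond (eq_bigl _ _ (pitau_fix_porbit x)) /F.
case: (odd _) => /=; last by rewrite big_pred0 // mul0r.
rewrite big_pred1_eq card_porbit_sq /= porbit_perm.
have -> n : lcmn n n = n.
  by apply/eqP; rewrite eqn_dvd dvdn_lcm !dvdnn dvdn_lcml.
by rewrite mul1r.
Qed.

Lemma natr_card_sq_orbits (lambda : seq nat) (hlambda : has_cycle_type pi lambda) :
  (#|sq_orbits pi|)%:R =
  \sum_(l <- lambda) \sum_(m <- lambda) (1 + (e2 l m)%:R) * (gcdn l m)%:R :> rat.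
Proof.
have -> : sq_orbits pi = [set C in porbits sq | xpredT C].
  by rewrite sq_orbitsE; apply/setP => C; rewrite inE andbT.
rewrite card_porbits_weight /=.
pose w l m : rat := ((sq_order (lcmn l m))%:R)^-1.
transitivity (\sum_x \sum_y w #|porbit pi x| #|porbit pi y|).
  by rewrite pair_bigA; apply: eq_bigr => -[x y] _; rewrite card_porbit_sq.
rewrite (sum_card_porbit (fun l => \sum_y w l #|porbit pi y|) hlambda).
rewrite !big_seq; apply: eq_bigr => l ll.
rewrite (sum_card_porbit (w l) hlambda) mulr_sumr !big_seq.
apply: eq_bigr => m mm; rewrite mulrA -natrM muln_sq_order_lcm /w.
rewrite natrM mulrAC divff ?mul1r ?natrM ?natrD //.
rewrite pnatr_eq0 -lt0n sq_order_gt0 // lcmn_gt0.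
by rewrite !(cycle_type_gt0 hlambda).
Qed.

Lemma card_moved_pairs (lambda : seq nat) (hlambda : has_cycle_type pi lambda) :
  (#|moved_pairs pi|)%:R = zeta lambda.
Proof.
have := congr1 (fun n => n%:R : rat) card_sq_orbits.
rewrite /= natrD natrM (natr_card_sq_orbits hlambda) (card_fixed_orbits hlambda).
rewrite (big_nth 0%N) big_mkord.
under eq_bigr => i _ do rewrite (big_nth 0%N) big_mkord.
pose l := nth 0%N lambda.
rewrite (@sum_symmetric _
  (fun i j => (1 + (e2 (l i) (l j))%:R) * (gcdn (l i) (l j))%:R)); last first.
  by move=> i j; rewrite gcdnC /e2 orbC.
rewrite /zeta /eta -/l; set S := \sum_(i < _) \sum_(j < _ | _) _.
set D := \sum_(i < _) (_ * _); set E := \sum_(i < _) (_ + _).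
set Z := \sum_(i < _) (_ - _) => H.
(* Termwise, with [L] a cycle length: [(1 + e) * (L + 1) - 2 * (f + 1) = (1 + e) * L - (1 - e + 2 *
   f)], the diagonal orbit count minus the [eta] term. *)
have -> : Z = D - E.
  rewrite -sumrB; apply: eq_bigr => i _.
  by rewrite gcdnn /e2 orbb -/(e1 (l i)); ring.
have -> : D = E + (#|moved_pairs pi|)%:R * 2%:R - 2%:R * S by rewrite -H; ring.
by field.
Qed.

End PairOrbits.

Theorem theorem8p4 (r : nat) (pi : 'S_r) (lambda : seq nat)
    (hlambda : has_cycle_type pi lambda) :
  [/\ (#|fixed_orbits pi|)%:R = eta lambda,
      (#|moved_pairs pi|)%:R = zeta lambda
    & partition (moved_pairs pi) (moved_orbits pi)].
Proof.
split; [exact: card_fixed_orbits | exact: card_moved_pairs |].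
exact: moved_pairs_partition.
Qed.
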